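(* Let $Y$ be a finite set of real numbers and let $h:D\to Y$ be a function on the unit simplex $D$ such that every level set $\{p\in D:h(p)=y\}$, $y\in Y$, is Lebesgue measurable. Then for every $\epsilon>0$ there exists a computable box function $h_\epsilon:D\to Y$ such that the set $\{p\in D: h(p)\ne h_\epsilon(p)\}$ has measure at most $\epsilon$.
   Context: $X=\{0,1,\ldots,K\}$ and $D=\{(p_0,\ldots,p_K)\in[0,1]^{K+1}:\sum_{k=0}^K p_k=1\}$, equipped with ($K$-dimensional) Lebesgue measure. A rational open box is a set of the form $\prod_{k=0}^K(a_k,b_k)$ with all $a_k,b_k$ rational. A box function is a function on $D$ that can be written as a finite sum $\sum_i a_i1_{B_i}$, where the $B_i$ are rational open boxes, $1_{B_i}$ are their indicator functions, and $a_i$ are real coefficients. For $x\in X^n$ let $p_k(x_1,\ldots,x_n)=|\{i:x_i=k\}|/n$. A function $h:D\to Y$ is called computable if the function family $(f_n)_{n=1,2,\ldots}$, $f_n:X^n\to Y$, given by $f_n(x)=h(p_0(x),p_1(x),\ldots,p_K(x))$ is computable in the following sense. Model of computation. $X$ is a finite input set and $Y$ a finite output set. A network is a triple $(n,G,\mathcal L)$ where $n\ge 2$ is the number of nodes, $G=(V,E)$ is a connected bidirectional graph on $V=\{1,\ldots,n\}$ (a directed graph without self-loops such that $(i,j)\in E$ implies $(j,i)\in E$), $d(i)$ is the degree of node $i$ (its in-degree, equal to its out-degree), and $\mathcal L$ is a port labeling: it assigns to the outgoing edges of each node $i$ distinct integers (port numbers) from $\{0,1,\ldots,d(i)\}$.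 An algorithm is a family of finite automata $(A_d)_{d=1,2,\ldots}$. A state of $A_d$ is a tuple $[x,z,y;(m_1,\ldots,m_d)]$ with $x\in X$ (initial value), $z\in Z_d$ (internal memory state), $y\in Y$ (output), $m_1,\ldots,m_d\in M$ (outgoing messages). The sets $Z_d$ (which may depend on $d$) and $M$ are finite. The sets $Y,Z_d,M$ in the state space are assumed to contain a special symbol $\emptyset$ (adjoined if necessary). $A_d$ is identified with a map from $X\times Z_d\times Y\times M^d$ to itself that does not change $x$. Execution: given initial values $x_1,\ldots,x_n\in X$, node $i$ runs $A_{d(i)}$ started at time $0$ with $x=x_i$ and $z=y=m_1=\cdots=m_{d(i)}=\emptyset$. At each node, order the outgoing edges by increasing port number. Let $j_k$ be the node at the other end of the $k$th outgoing edge of $i$, and let $p_k$ (in this paragraph) be the position of the edge $(j_k,i)$ in the ordering at $j_k$. For $t=0,1,2,\ldots$ all nodes simultaneously update $$[x_i,z_i(t+1),y_i(t+1);m_{i,1}(t+1),\ldots,m_{i,d(i)}(t+1)]=A_{d(i)}[x_i,z_i(t),y_i(t);m_{j_1,p_1}(t),\ldots,m_{j_{d(i)},p_{d(i)}}(t)].$$ The algorithm terminates with final output $y^*\in Y$ if there is a time $t'$ with $y_i(t)=y^*$ for all nodes $i$ and all $t\ge t'$. A family $(f_n)$, $f_n:X^n\to Y$, is computable if there is an algorithm $(A_d)$ (not depending on $n$ or the network) such that for every $n$, every network $(n,G,\mathcal L)$ and all initial values $x_1,\ldots,x_n\in X$ the algorithm terminates with final output $f_n(x_1,\ldots,x_n)$.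 *)

(* Defs.v *)
(* MathComp / MathComp-Analysis *)
From HB Require Import structures.
From mathcomp Require Import all_boot all_order all_algebra finmap.
From mathcomp Require Import all_classical all_reals all_analysis.

Set Implicit Arguments.
Unset Strict Implicit.
Unset Printing Implicit Defensive.

Import Order.TTheory GRing.Theory Num.Theory.

Local Open Scope classical_set_scope.
Local Open Scope ring_scope.

Definition degree n (e : rel 'I_n) (i : 'I_n) : nat := #|e i|.

(* [port i j] is the label of the outgoing edge (i, j); its value is irrelevant
   when (i, j) is not an edge. *)
Record network (n : nat) := Network {
  edge : rel 'I_n;
  port : 'I_n -> 'I_n -> nat;
  network_ge2 : (2 <= n)%N;
  edge_irrefl : irreflexive edge;
  edge_bidir : forall i j, edge i j -> edge j i;
  edge_connected : forall i j, connect edge i j;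
  port_le_degree : forall i j, edge i j -> (port i j <= degree edge i)%N;
  port_distinct : forall i, {in edge i &, injective (port i)}
}.

(* The type [option Y] is Y with the special symbol (None) adjoined; [memory0]
   and [message0] are the special symbols of the sets Z_d and M.  The component
   x of a state is not part of the result of [transition], because A_d does not
   change it. *)
Record algorithm (X Y : finType) := Algorithm {
  memory : nat -> finType;
  memory0 : forall d, memory d;
  message : finType;
  message0 : message;
  transition : forall d : nat,
    X -> memory d -> option Y -> d.-tuple message ->
    memory d * option Y * d.-tuple message
}.

Section Execution.
Variables (X Y : finType) (A : algorithm X Y) (n : nat) (N : network n).

Definition deg (i : 'I_n) : nat := degree (edge N) i.

(* The out-neighbours of i, by increasing port number at i. *)
Definition neighbors (i : 'I_n) : seq 'I_n :=
  sort (fun j j' => (port N i j <= port N i j')%N) (enum (edge N i)).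

Definition configuration : Type :=
  forall i : 'I_n, memory A (deg i) * option Y * (deg i).-tuple (message A).

(* Since [neighbors i] has size [deg i] and edges are bidirectional, the default
   values of the two occurrences of [nth] are never used. *)
Definition received (c : configuration) (i : 'I_n) : (deg i).-tuple (message A) :=
  [tuple (let j := nth i (neighbors i) k in
          nth (message0 A) (c j).2 (index i (neighbors j))) | k < deg i].

Definition initial : configuration :=
  fun i => (memory0 A (deg i), None, [tuple message0 A | _ < deg i]).

Definition step (x : {ffun 'I_n -> X}) (c : configuration) : configuration :=
  fun i => transition (x i) (c i).1.1 (c i).1.2 (received c i).

Definition run (x : {ffun 'I_n -> X}) (t : nat) : configuration :=
  iter t (step x) initial.

Definition output (x : {ffun 'I_n -> X}) (t : nat) (i : 'I_n) : option Y :=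
  (run x t i).1.2.

Definition terminates_with (x : {ffun 'I_n -> X}) (y : Y) : Prop :=
  exists t', forall t, (t' <= t)%N -> forall i, output x t i = Some y.

End Execution.

(* The family is indexed by n >= 1, hence the successors. *)
Definition computable_family (X Y : finType)
    (f : forall n : nat, {ffun 'I_n.+1 -> X} -> Y) : Prop :=
  exists A : algorithm X Y,
    forall (n : nat) (N : network n.+1) (x : {ffun 'I_n.+1 -> X}),
      terminates_with A N x (f n x).

Section Simplex.
Variables (R : realType) (K : nat).

Definition in_simplex : pred 'rV[R]_K.+1 :=
  fun p => [forall k, 0 <= p 0 k <= 1] && (\sum_k p 0 k == 1).

Definition simplex : Type := {p : 'rV[R]_K.+1 | in_simplex p}.

Definition freq n (x : {ffun 'I_n.+1 -> 'I_K.+1}) : 'rV[R]_K.+1 :=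
  \row_k (#|[pred i | x i == k]|%:R / n.+1%:R).

Lemma freq_in_simplex n (x : {ffun 'I_n.+1 -> 'I_K.+1}) : in_simplex (freq x).
Proof.
apply/andP; split.
  apply/forallP => k; rewrite mxE; apply/andP; split.
    by rewrite divr_ge0 ?ler0n.
  rewrite ler_pdivrMr ?ltr0Sn // mul1r ler_nat -[leqRHS]card_ord.
  exact: max_card.
under eq_bigr do rewrite mxE.
rewrite -mulr_suml -natr_sum.
suff -> : (\sum_k #|[pred i | x i == k]| = n.+1)%N.
  by rewrite divff // pnatr_eq0.
rewrite -[RHS](card_ord n.+1) -sum1_card (partition_big x predT) //=.
apply: eq_bigr => k _; rewrite -sum1_card.
by apply: eq_bigl => i; rewrite inE.
Qed.

Definition freq_simplex n (x : {ffun 'I_n.+1 -> 'I_K.+1}) : simplex :=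
  exist _ (freq x) (freq_in_simplex x).

Definition computable (Y : finType) (h : simplex -> Y) : Prop :=
  computable_family (fun n (x : {ffun 'I_n.+1 -> 'I_K.+1}) => h (freq_simplex x)).

Definition rational_open_box (a b : 'rV[rat]_K.+1) : set 'rV[R]_K.+1 :=
  [set p | forall k, ratr (a 0 k) < p 0 k < ratr (b 0 k)].

Definition box_function (h : simplex -> R) : Prop :=
  exists (m : nat) (c : 'I_m -> R) (a b : 'I_m -> 'rV[rat]_K.+1),
    forall p : simplex,
      h p = \sum_(i < m) c i * \1_(rational_open_box (a i) (b i)) (val p).

End Simplex.

Section Lebesgue.
Variable R : realType.

Definition oc_box d (a b : 'rV[R]_d) : set 'rV[R]_d :=
  [set p | forall k, a 0 k < p 0 k <= b 0 k].

Definition box_volume d (a b : 'rV[R]_d) : R :=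
  \prod_(k < d) Num.max 0 (b 0 k - a 0 k).

(* Lebesgue outer measure on R^d.  The covers are indexed by a subset I of nat,
   so that finite and empty covers are allowed also when d = 0, where every box
   has volume 1. *)
Definition lebesgue_outer d (A : set 'rV[R]_d) : \bar R :=
  ereal_inf [set v | exists (I : set nat) (a b : nat -> 'rV[R]_d),
    A `<=` \bigcup_(i in I) oc_box (a i) (b i) /\
    v = (\esum_(i in I) (box_volume (a i) (b i))%:E)%E].

Variable K : nat.

Definition simplex_chart (p : simplex R K) : 'rV[R]_K :=
  \row_(k < K) (val p) 0 (lift ord0 k).

Definition simplex_measurable (A : set (simplex R K)) : Prop :=
  (@lebesgue_outer K).-caratheodory (simplex_chart @` A).

(* The K-dimensional Lebesgue measure of the affine hull of D, that is, of the
   hyperplane with equation p_0 + ... + p_K = 1: the chart that forgets p_0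
   divides volumes by sqrt (K + 1). *)
Definition simplex_measure (A : set (simplex R K)) : \bar R :=
  ((Num.sqrt K.+1%:R)%:E * lebesgue_outer (simplex_chart @` A))%E.

End Lebesgue.

(* Main.v *)
Require Import Defs.
From HB Require Import structures.
From mathcomp Require Import all_boot all_order all_algebra finmap.
From mathcomp Require Import all_classical all_reals all_analysis.
From mathcomp Require Import zify ring lra.

Set Implicit Arguments.
Unset Strict Implicit.
Unset Printing Implicit Defensive.

(** The function [heps] is a decision list: [heps p] is the first value [y]
whose region [U y], a finite union of rational open boxes, contains the chart
point of [p], or a fixed value if there is none.  This shape makes the three
requirements separate concerns.

The error is small as soon as each [U y] approximates the level set of [y] in
measure, because [heps] agrees with [h] wherever every [U y] agrees with its
level set.  Such a [U y] exists for every Caratheodory measurable set of finite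
outer measure ([caratheodory_approx]): cover the set by boxes of nearly minimal
total volume, enlarge them slightly to rational open boxes, and keep finitely
many.  Caratheodory's condition, applied with the union of the cover as test
set, bounds what the cover adds to the set by the excess of its total volume;
so the outer measure of a box never has to be computed.

The decision list is a box function because indicators of boxes are closed under
products, so box functions form an algebra and are closed under case distinction
([box_function_if]).

It is computable because it is a Boolean combination of tests [p_k < q] and
[q < p_k] with [q] rational, and algorithms can be run side by side
([computable_family_map2]).  On the frequencies of an input, each test has the
form [sum_i a(x_i) < sum_i b(x_i)] with [a] and [b] natural-valued, and one
algorithm decides this ([token_algorithm_correct]).  Node [i] starts with
[a(x_i)] tokens and a debt [b(x_i)].  Tokens never rest: each node forwards them
through its ports in cyclic order, so tokens that survive forever visit every
node infinitely often; debts stay where they are and swallow the tokens that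
arrive.  The difference between tokens and debts is invariant, hence some debt
is permanent if and only if the inequality holds ([debt_persists],
[debts_vanish]).

The nodes must then learn whether a permanent debt exists, in finite memory and
although debts may disappear at unpredictable times.  Nodes in debt act as
sources of light; a dark node with a bright neighbor takes it as parent and
becomes lit, but becomes bright, hence able to light others, only one step
later, and a node goes dark as soon as its parent is dark.  Darkness thus
travels twice as fast as light: a lit node cut off from every source has an
ancestor line that gains one member per step while the times at which its
members were lit go back two steps per member, which bounds its life span
([stale_or_forever]).  So light that has no permanent source dies out
([lit_none]), and a permanent source eventually lights everything
([lit_all]). *)

(** * Eventual behavior *)

Lemma nonincreasing_stationary (f : nat -> nat) (T : nat) :
  (forall t, T <= t -> f t.+1 <= f t) ->
  exists2 T', T <= T' & forall t, T' <= t -> f t = f T'.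
Proof.
have [m] := ubnP (f T); elim: m T => // m IHm T fTm f_noninc.
have [[t [tT ft]]|] := EM (exists t, T <= t /\ f t < f T).
  have [||T' tT' fT'] := IHm t; first by lia.
    by move=> u tu; apply: f_noninc; lia.
  by exists T' => //; lia.
move=> f_ge; exists T => // t Tt.
have le_f : f t <= f T.
  elim: t Tt => [|t IHt]; first by rewrite leqn0 => /eqP ->.
  rewrite leq_eqVlt => /orP[/eqP<-//|]; rewrite ltnS => Tt.
  exact: leq_trans (f_noninc _ Tt) (IHt Tt).
by apply/eqP; rewrite eqn_leq le_f leqNgt; apply/negP => ltf; apply: f_ge; exists t.
Qed.

Lemma uniform_time (V : finType) (P : nat -> V -> Prop) :
  (forall i, exists T, forall t, T <= t -> P t i) ->
  exists T, forall t, T <= t -> forall i, P t i.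
Proof.
move=> evP.
suff [T PT] : exists T, forall i, i \in enum V -> forall t, T <= t -> P t i.
  by exists T => t Tt i; apply: PT; rewrite ?mem_enum.
elim: (enum V) => [|i s [T PT]]; first by exists 0.
have [T' PT'] := evP i; exists (maxn T T') => j; rewrite inE => /orP[/eqP->|js] t.
  by rewrite geq_max => /andP[_ /PT'].
by rewrite geq_max => /andP[Tt _]; apply: PT.
Qed.

Lemma connect_propagate (V : finType) (e : rel V) (P : V -> Prop) i j :
  (forall u v, e u v -> P u -> P v) -> connect e i j -> P i -> P j.
Proof.
move=> step /connectP[p]; elim: p i => [|k p IHp] i /= => [_ -> //|].
by move=> /andP[eik pk] jE Pi; apply: IHp pk jE (step _ _ eik Pi).
Qed.

(** * Serving ports in cyclic order *)

Section Serials.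
Variable d : nat.
Hypothesis d_gt0 : 0 < d.

(** Tokens leaving a node of degree [d] carry consecutive serial numbers, and token
[s] leaves through port [s %% d].  The ports used depend on the first number [r]
only modulo [d], so a finite memory suffices. *)
Definition served (k r m : nat) : nat := count (fun s => s %% d == k) (iota r m).

Lemma sum_served r m : \sum_(k < d) served k r m = m.
Proof.
rewrite /served; elim: m r => [|m IHm] r /=; first by rewrite big1.
rewrite big_split /= IHm.
rewrite (bigD1 (Ordinal (ltn_pmod r d_gt0))) //= eqxx big1 //= => k.
by rewrite eq_sym -val_eqE /= => /negPf ->.
Qed.

Lemma served_round k r : served k r d <= 1.
Proof.
rewrite leqNgt /served -size_filter; apply/negP.
have : uniq [seq s <- iota r d | s %% d == k] by rewrite filter_uniq ?iota_uniq.
have : {subset [seq s <- iota r d | s %% d == k] <=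
         [pred s | (s %% d == k) && (r <= s < r + d)]}.
  by move=> s; rewrite mem_filter mem_iota.
case: seq.filter => [|s [|s' l]] //= sub /andP[]; rewrite inE => /norP[/eqP neq _] _ _.
have := sub s; rewrite !inE eqxx => /(_ isT) /andP[/eqP sk sr].
have := sub s'; rewrite !inE eqxx orbT => /(_ isT) /andP[/eqP s'k s'r].
apply: neq; move: sk; rewrite -s'k => ss'.
have [le|le] := leqP s s'.
  have : d %| s' - s by rewrite -eqn_mod_dvd //; apply/eqP.
  by have [/eqP|pos /(dvdn_leq pos)] := posnP (s' - s); lia.
have : d %| s - s' by rewrite -eqn_mod_dvd ?(ltnW le) //; apply/eqP.
by have [/eqP|pos /(dvdn_leq pos)] := posnP (s - s'); lia.
Qed.

(** The capacity bound of the algorithm: if at most [L] tokens arrive through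
each port, then at most [L] leave through each port, so messages are bounded. *)
Lemma served_le L k r m : m <= L * d -> served k r m <= L.
Proof.
elim: L r m => [|L IHL] r m.
  by rewrite mul0n leqn0 => /eqP->.
rewrite mulSn => mL; have [md|dm] := leqP m d.
  apply: leq_trans (_ : served k r d <= _); last exact: leq_trans (served_round _ _) _.
  by rewrite /served -(subnKC md) iotaD count_cat leq_addr.
rewrite /served -(subnKC (ltnW dm)) iotaD count_cat -add1n.
by rewrite leq_add ?served_round ?IHL //; lia.
Qed.

(** The number of tokens that will leave before port [k] is served again. *)
Definition wait (k r : nat) : nat := if r <= k then k - r else k + d - r.

(** As long as port [k] is idle, every departure shortens its waiting time, so a
node with an idle port emits only finitely many tokens. *)
Lemma unserved k r m : k < d -> r < d -> served k r m = 0 ->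
  m <= wait k r /\ wait k ((r + m) %% d) = wait k r - m.
Proof.
move=> kd rd s0.
have mw : m <= wait k r.
  rewrite leqNgt; apply/negP => lt; move: s0; apply/eqP.
  rewrite -lt0n -has_count; apply/hasP; exists (r + wait k r).
    by rewrite mem_iota leq_addr ltn_add2l.
  rewrite /wait; case: (leqP r k) => rk; first by rewrite subnKC // modn_small.
  by rewrite subnKC ?modnDr ?modn_small //; lia.
split => //; move: mw; rewrite /wait; case: (leqP r k) => rk mw.
  by rewrite modn_small; [case: (leqP (r + m) k)|]; lia.
have [lt|ge] := ltnP (r + m) d.
  by rewrite modn_small //; case: (leqP (r + m) k); lia.
by rewrite -(subnK ge) modnDr modn_small; [case: leqP|]; lia.
Qed.

End Serials.

(** * Tokens and debts on a connected graph *)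

Section Tokens.
Variables (V : finType) (e : rel V) (nb : V -> seq V).
Hypotheses (e_sym : symmetric e) (e_conn : forall i j, connect e i j).
Hypotheses (mem_nb : forall i j, (j \in nb i) = e i j) (nb_uniq : forall i, uniq (nb i)).
Let d i := size (nb i).
Hypothesis d_gt0 : forall i, 0 < d i.

(** Both sides sum over all directed edges. *)
Lemma sum_received (F : V -> nat -> nat) :
  \sum_i \sum_(j <- nb i) F j (index i (nb j)) = \sum_j \sum_(k < d j) F j k.
Proof.
under eq_bigr do rewrite big_uniq //.
rewrite (exchange_big_dep xpredT) //=; apply: eq_bigr => j _.
rewrite -(big_mkord xpredT (F j)).
rewrite (eq_bigl (mem (nb j))) => [|i]; last by rewrite /= !mem_nb e_sym.
rewrite -big_uniq // (big_nth j); apply: eq_big_nat => k kd.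
by rewrite index_uniq.
Qed.

(** [S t i], [D t i] and [r t i] are the tokens arriving, the debt and the next
serial number at node [i] at time [t]; [flow t i k] is the content of port [k].
The equation for [flow] is assumed only below the capacity [L], where a bounded
message can hold it; [arrivals_le] shows that the capacity is never exceeded. *)
Variables (L : nat) (a b : V -> nat) (S D r : nat -> V -> nat)
  (flow : nat -> V -> nat -> nat).
Hypotheses
  (aL : forall i, a i <= L)
  (S0 : forall i, S 0 i = a i) (D0 : forall i, D 0 i = b i) (r0 : forall i, r 0 i = 0)
  (SS : forall t i, S t.+1 i = \sum_(j <- nb i) flow t.+1 j (index i (nb j)))
  (DS : forall t i, D t.+1 i = D t i - S t i)
  (rS : forall t i, r t.+1 i = (r t i + (S t i - D t i)) %% d i)
  (flowS : forall t i k, k < d i ->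
     let m := served (d i) k (r t i) (S t i - D t i) in
     m <= L -> flow t.+1 i k = m).

Lemma arrivals_le t i : S t i <= L * d i.
Proof.
elim: t i => [|t IHt] i.
  by rewrite S0; apply: leq_trans (aL i) _; rewrite leq_pmulr.
rewrite SS (big_nth i) big_mkord mulnC -[d i]card_ord -sum_nat_const.
apply: leq_sum => -[k kd] _ /=.
set j := nth i (nb i) k.
have ij : j \in nb i by rewrite mem_nth.
have kj : index i (nb j) < d j by rewrite index_mem mem_nb e_sym -mem_nb.
have le : served (d j) (index i (nb j)) (r t j) (S t j - D t j) <= L.
  by apply: served_le => //; apply: leq_trans (leq_subr _ _) _.
by rewrite flowS.
Qed.

Lemma flowE t i k : k < d i ->
  flow t.+1 i k = served (d i) k (r t i) (S t i - D t i).
Proof.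
move=> kd; apply: flowS => //; apply: served_le => //.
by apply: leq_trans (leq_subr _ _) (arrivals_le _ _).
Qed.

(** The invariant: tokens in transit minus debts. *)
Lemma sum_arrivals t :
  \sum_i S t i + \sum_i b i = \sum_i a i + \sum_i D t i.
Proof.
elim: t => [|t IHt].
  by congr (_ + _); apply: eq_bigr => i _; rewrite ?S0 ?D0.
have -> : \sum_i S t.+1 i = \sum_i (S t i - D t i).
  under eq_bigr do rewrite SS.
  rewrite sum_received; apply: eq_bigr => i _.
  rewrite -[RHS](sum_served (d_gt0 i) (r t i)).
  by apply: eq_bigr => k _; rewrite flowE.
have : \sum_i (S t i - D t i) + \sum_i D t i = \sum_i S t i + \sum_i D t.+1 i.
  by rewrite -!big_split; apply: eq_bigr => i _; rewrite DS /=; lia.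
lia.
Qed.

Lemma r_lt t i : r t i < d i.
Proof. by case: t => [|t]; rewrite ?r0 // rS ltn_pmod. Qed.

(** By the invariant, debts exceed tokens at all times; and a debt that has been
paid never returns, so some node is in debt forever. *)
Lemma debt_persists : \sum_i a i < \sum_i b i -> exists i, forall t, 0 < D t i.
Proof.
move=> ab; apply: contrapT => none.
have [i|T DT] := @uniform_time V (fun t i => D t i = 0).
  have [[T DT]|pos] := EM (exists T, D T i = 0).
    exists T => t; elim: t => [|t IHt]; first by case: T DT.
    rewrite leq_eqVlt => /orP[/eqP<-//|]; rewrite ltnS => Tt.
    by rewrite DS IHt.
  by case: none; exists i => t; rewrite lt0n; apply/eqP => Dt; apply: pos; exists t.
have := sum_arrivals T; rewrite [X in _ = _ + X]big1 => [|i _]; last by rewrite DT.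
lia.
Qed.

Definition quiet i := exists T, forall t, T <= t -> S t i = 0.

(** Debts are eventually constant.  A node that remains in debt is from then on
never visited, so the ports leading to it are idle and its neighbors emit only
finitely many tokens; they absorb none either, hence they are eventually not
visited.  Being eventually unvisited thus spreads to all nodes: no token is left
while a debt is, against the invariant. *)
Lemma debts_vanish : \sum_i b i <= \sum_i a i ->
  exists T, forall t, T <= t -> forall i, D t i = 0.
Proof.
move=> ba.
have [t _|T _ sDT] := @nonincreasing_stationary (fun t => \sum_i D t i) 0.
  by apply: leq_sum => i _; rewrite DS leq_subr.
have Dconst t i : T <= t -> D t.+1 i = D t i.
  move=> Tt.
  have /eqP : \sum_i D t.+1 i = \sum_i D t i by rewrite !sDT //; lia.
  rewrite eq_sym => /eqP sumE.
  have := leqif_sum (fun i (_ : true) => leqif_eq (leq_subr (S t i) (D t i))).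
  case=> _; under eq_bigr do rewrite -DS.
  by rewrite sumE eqxx => /esym /forallP /(_ i) /eqP; rewrite -DS.
(* An arrival at a node in debt would decrease the total debt. *)
have SD t i : T <= t -> S t i = 0 \/ D t i = 0.
  by move=> Tt; have := Dconst t i Tt; rewrite DS; lia.
have [i0 Di0|D_0] := pickP (fun i => 0 < D T i); last first.
  exists T => t Tt i; apply/eqP.
  have : \sum_i D t i = 0.
    by rewrite sDT // big1 // => j _; move: (D_0 j); rewrite /=; lia.
  by move/eqP; rewrite sum_nat_eq0 => /forallP /(_ i).
have D_i0 t : T <= t -> 0 < D t i0.
  elim: t => [|t IHt]; first by rewrite leqn0 => /eqP T0; rewrite -[in D _ _]T0.
  rewrite leq_eqVlt => /orP[/eqP<-//|]; rewrite ltnS => Tt.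
  by rewrite Dconst // IHt.
have quiet_i0 : quiet i0.
  by exists T => t Tt; have := D_i0 t Tt; have := SD t i0 Tt; lia.
have quiet_step u v : e u v -> quiet u -> quiet v.
  move=> uv [T' ST'].
  have kd : index u (nb v) < d v by rewrite index_mem mem_nb e_sym.
  set k := index u (nb v) in kd.
  have flow0 t : T' <= t -> served (d v) k (r t v) (S t v - D t v) = 0.
    move=> Tt; rewrite -flowE //; have := ST' t.+1 (leqW Tt); rewrite SS.
    rewrite big_uniq //= (bigD1 v) ?mem_nb //= -/k; lia.
  have [t Tt|T2 le2 wT2] :=
      @nonincreasing_stationary (fun t => wait (d v) k (r t v)) (maxn T T').
    have [_] := unserved (d_gt0 v) kd (r_lt t v) (flow0 t (leq_trans (leq_maxr _ _) Tt)).
    by rewrite -rS => ->; rewrite leq_subr.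
  exists T2 => t T2t.
  have [Tt T't] : T <= t /\ T' <= t by lia.
  have [le] := unserved (d_gt0 v) kd (r_lt t v) (flow0 t T't).
  rewrite -rS; have := wT2 t T2t; have := wT2 t.+1 (leqW T2t).
  have := SD t v Tt; lia.
have quiet_all v : quiet v.
  exact: connect_propagate quiet_step (e_conn i0 v) quiet_i0.
have [T2 ST2] := uniform_time quiet_all.
have := sum_arrivals (maxn T T2); rewrite big1 => [|i _]; last first.
  by rewrite ST2 ?leq_maxr.
have := D_i0 _ (leq_maxl T T2).
by rewrite add0n [\sum_i D _ i](bigD1 i0) //=; lia.
Qed.

End Tokens.

(** * Detecting a permanent source in finite memory *)

Section Beacon.
Variables (V : finType) (e : rel V).
Hypotheses (e_sym : symmetric e) (e_conn : forall i j, connect e i j).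
(** [R t i]: node [i] is a source at time [t].  [st t i] is [None] for a node that
has no parent, and [Some (j, o)] for a node lit by its parent [j], where [o]
tells whether it has been lit for at least one step. *)
Variables (R : nat -> V -> bool) (st : nat -> V -> option (V * bool)).

Definition lit t i := R t i || st t i.
Definition bright t i := R t i || (if st t i is Some (_, o) then o else false).

Hypotheses
  (R_decr : forall t i, R t.+1 i -> R t i)
  (st0 : forall i, st 0 i = None)
  (st_source : forall t i, R t i -> st t.+1 i = None)
  (st_keep : forall t i j o, ~~ R t i -> st t i = Some (j, o) ->
     st t.+1 i = if lit t j then Some (j, true) else None)
  (st_adopt : forall t i, ~~ R t i -> st t i = None ->
     if st t.+1 i is Some (j, o) then bright t j /\ ~~ o
     else forall j, e i j -> ~~ bright t j).

(** The time at which the current lit period of [i] began, shifted by one so that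
the initial sources, born at 0, are older than a node lit at any step. *)
Fixpoint birth t i : nat :=
  if t is t'.+1 then if lit t' i then birth t' i else t'.+2 else 0.

Lemma birth_le t i : birth t i <= t.+1.
Proof. by elim: t => //= t IHt; case: ifP => // _; apply: leqW. Qed.

Lemma R_mono s t i : s <= t -> R t i -> R s i.
Proof.
elim: t => [|t IHt]; first by rewrite leqn0 => /eqP->.
by rewrite leq_eqVlt => /orP[/eqP->//|st_ /R_decr]; apply: IHt.
Qed.

Lemma birth_source t i : R t i -> birth t i = 0.
Proof.
elim: t => //= t IHt Rt; have Rt' := R_decr Rt.
by rewrite /lit Rt' IHt.
Qed.

Lemma birth_bright t i : bright t i -> birth t i <= t.
Proof.
rewrite /bright; case: (boolP (R t i)) => [Rt _|_ /=].
  by rewrite birth_source.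
case: t => //= t; case: (boolP (R t i)) => [Rt|nRt].
  by rewrite st_source.
case stE: (st t i) => [[j o]|].
  by rewrite /lit stE orbT birth_le.
have := st_adopt nRt stE; case: (st t.+1 i) => [[j o] [_ /negPf-> //]|//].
Qed.

(** The delay before a lit node becomes bright makes every parent at least two
steps older than its children. *)
Lemma birth_parent t i j o : st t.+1 i = Some (j, o) ->
  lit t j /\ (birth t j).+2 <= birth t.+1 i.
Proof.
elim: t i j o => [|t IHt] i j o.
  case: (boolP (R 0 i)) => [Rt|nRt]; first by rewrite st_source.
  move=> stE; have := st_adopt nRt (st0 i); rewrite stE => -[brj _].
  split; first by move: brj; rewrite /lit /bright st0 /= !orbF.
  by rewrite /= /lit (negPf nRt) st0.
case: (boolP (R t.+1 i)) => [Rt|nRt]; first by rewrite st_source.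
case stE: (st t.+1 i) => [[j' q]|] stE'.
  move: stE'; rewrite (st_keep nRt stE); case: ifP => // litj [<- _].
  split=> //; have [litj' le] := IHt _ _ _ stE.
  have -> : birth t.+2 i = birth t.+1 i by rewrite /= {1}/lit stE orbT.
  by have -> : birth t.+1 j' = birth t j' by rewrite /= litj'.
have := st_adopt nRt stE; rewrite stE' => -[brj _]; split.
  by move: brj; rewrite /lit /bright; case: (R _ _) => //=; case: (st _ _).
have -> : birth t.+2 i = t.+3 by rewrite /= {1}/lit stE (negPf nRt).
by rewrite !ltnS birth_bright.
Qed.

Lemma lit_parent_forever T i j o : st T.+1 i = Some (j, o) ->
  (forall t, T <= t -> lit t j) -> forall t, T < t -> lit t i.
Proof.
move=> stT litj.
case: (boolP (R T i)) => [Rt|nRt]; first by rewrite st_source in stT.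
suff H t : T < t -> exists q, st t i = Some (j, q).
  by move=> t /H [q stE]; rewrite /lit stE orbT.
elim: t => // t IHt; rewrite ltnS leq_eqVlt => /orP[/eqP<-|]; first by exists o.
move=> Tt; have [q stE] := IHt Tt.
have nR : ~~ R t i by apply: contra nRt; apply: R_mono; apply: ltnW.
by rewrite (st_keep nR stE) litj; [exists true|apply: ltnW].
Qed.

(** Once the sources no longer change, a lit node either descends from a permanent
source, and then stays lit, or owes its light to a node that was in the same
situation one step earlier.  In the second case births are pushed up by two at
each step, while they never exceed the current time plus one: such nodes cannot
exist for long. *)
Lemma stale_or_forever T : (forall t i, T <= t -> R t i = R T i) ->
  forall k i, lit (T + k) i ->
  2 * k <= birth (T + k) i \/
  (exists j, R T j) /\ (forall t, T + k <= t -> lit t i).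
Proof.
move=> RT; elim=> [|k IHk] i; first by left.
rewrite addnS; case: (boolP (R (T + k).+1 i)) => [Rt _|nRt].
  have RTi : R T i by rewrite -(RT _ _ (_ : T <= (T + k).+1)) // leqW ?leq_addr.
  right; split=> [|t Tt]; first by exists i.
  by rewrite /lit RT ?RTi //; lia.
rewrite /lit (negPf nRt) orFb; case stE: (st _ i) => [[j o]|//] _.
have [litj le] := birth_parent stE.
have [le'|[ex forev]] := IHk j litj; first by left; lia.
by right; split => //; apply: lit_parent_forever stE forev.
Qed.

Lemma sources_stationary : exists T, forall t i, T <= t -> R t i = R T i.
Proof.
have [i|T RT] := @uniform_time V (fun t i => R t i = ~~ `[< exists t, R t i = false >]).
  case: asboolP => [[T RT]|RT].
    by exists T => t Tt; apply/negbTE; apply: contraFN RT; apply: R_mono.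
  by exists 0 => t _; apply: contrapT => Rt; apply: RT; exists t; apply/negbTE/negP.
by exists T => t i Tt; rewrite !RT.
Qed.

(** Late enough, being lit is permanent, hence so is being bright, and the light
spreads along the edges. *)
Lemma lit_all : (exists i, forall t, R t i) ->
  exists T, forall t, T <= t -> forall i, lit t i.
Proof.
move=> [i0 Ri0]; have [T RT] := sources_stationary.
have forever i s : T + T.+2 <= s -> lit s i -> forall t, s <= t -> lit t i.
  move=> Ts; rewrite -(subnKC (_ : T <= s)); last by lia.
  move=> /(stale_or_forever RT)[|[] //].
  have := birth_le (T + (s - T)) i; lia.
apply: uniform_time => i; pose P v := exists T', forall t, T' <= t -> lit t v.
apply: (@connect_propagate _ e P i0 i) => //; last first.
  by exists 0 => t _; rewrite /lit Ri0.
move=> u v uv [Tu litu].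
set s := maxn (T + T.+2) Tu.
have brightu t : s < t -> bright t u.
  move=> st_; rewrite /bright; case: (boolP (R t u)) => //= nRt.
  case: t st_ nRt => // t st_ nRt.
  have := litu t.+1 ltac:(lia); have := litu t ltac:(lia).
  rewrite /lit (negPf nRt) /=; case: (boolP (R t u)) => [Rt|nRt'].
    by rewrite (st_source Rt).
  by case stE: (st t u) => [[j o]|//] _; rewrite (st_keep nRt' stE); case: ifP.
suff [s' ss' lits'] : exists2 s', s <= s' & lit s' v.
  by exists s' => t; apply: forever => //; lia.
have [litv|] := boolP (lit s.+1 v); first by exists s.+1.
rewrite /lit negb_or => /andP[nR]; case stE: (st _ v) => [//|] _.
exists s.+2; first by lia.
have := st_adopt nR stE; rewrite /lit; case: (st s.+2 v) => [p|/(_ u)]; first by rewrite orbT.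
by rewrite e_sym brightu // => /(_ uv).
Qed.

Lemma lit_none : (exists T, forall t, T <= t -> forall i, ~~ R t i) ->
  exists T, forall t, T <= t -> forall i, ~~ lit t i.
Proof.
move=> [T RT].
have RT' t i : T <= t -> R t i = R T i.
  by move=> Tt; rewrite (negPf (RT t Tt i)) (negPf (RT T (leqnn T) i)).
exists (T + T.+2) => t Tt i; rewrite -(subnKC (_ : T <= t)); last by lia.
apply/negP => /(stale_or_forever RT')[|[[j]]].
  have := birth_le (T + (t - T)) i; lia.
by rewrite (negPf (RT T (leqnn T) j)).
Qed.

End Beacon.

(** * The comparison algorithm *)

Section Networks.
Local Open Scope nat_scope.
Variables (n : nat) (N : network n).

Lemma mem_neighbors i j : (j \in neighbors N i) = edge N i j.
Proof. by rewrite mem_sort mem_enum. Qed.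

Lemma neighbors_uniq i : uniq (neighbors N i).
Proof. by rewrite sort_uniq enum_uniq. Qed.

Lemma size_neighbors i : size (neighbors N i) = deg N i.
Proof. by rewrite size_sort -cardE. Qed.

Lemma edge_sym : symmetric (edge N).
Proof. by move=> i j; apply/idP/idP; apply: edge_bidir. Qed.

Lemma deg_gt0 i : 0 < deg N i.
Proof.
have [j ji] : exists j : 'I_n, j != i.
  apply/existsP; rewrite -negb_forall; apply/negP => /forallP /= all_i.
  have := network_ge2 N; rewrite -[n]card_ord ltnNge; apply/negP; rewrite negbK.
  by rewrite -(card1 i); apply: subset_leq_card; apply/fintype.subsetP => j _; apply: all_i.
have /connectP[[|k p] /=] := edge_connected N i j.
  by move=> _ jE; rewrite jE eqxx in ji.
move=> /andP[ik _] _; apply/card_gt0P; exists k; exact: ik.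
Qed.

Lemma index_neighbors i j : j \in neighbors N i -> index i (neighbors N j) < deg N j.
Proof.
by move=> ji; rewrite -size_neighbors index_mem mem_neighbors edge_sym -mem_neighbors.
Qed.

Lemma tnth_received (X Y : finType) (A : algorithm X Y) (c : configuration A N) i
    (k : 'I_(deg N i)) :
  let j := nth i (neighbors N i) k in
  tnth (received c i) k = nth (message0 A) (c j).2 (index i (neighbors N j)).
Proof. by rewrite tnth_mktuple. Qed.

End Networks.

Section Threshold.
Local Open Scope nat_scope.
Variables (X : finType) (a b : X -> nat).
Let L := \max_x a x.
Let B := \max_x b x.

(** The flags of a message tell whether its sender is lit and whether it is bright.
A memory state holds the debt, the next serial number modulo the degree and the
port of the parent; it is [None] before the first step, when the input is still
to be loaded. *)
Definition token_message : finType := ('I_L.+1 * bool * bool)%type.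
Definition token_memory (d : nat) : finType :=
  option ('I_B.+1 * 'I_d.+1 * option ('I_d * bool)).

Section Transition.
Variables (d : nat) (x : X) (z : token_memory d) (m : d.-tuple token_message).

Definition debt : nat := if z is Some (D, _, _) then D else b x.
Definition rotor : nat := if z is Some (_, r, _) then r else 0.
Definition status : option ('I_d * bool) := if z is Some (_, _, s) then s else None.
Definition arrivals : nat :=
  (if z is Some _ then 0 else a x) + \sum_(k < d) (tnth m k).1.1.
Definition departures : nat := arrivals - debt.
Definition next_debt : nat := debt - arrivals.
(** A node in debt has no parent, hence it is dark at the moment when its debt is
paid, and its children notice that their source is gone. *)
Definition next_status : option ('I_d * bool) :=
  if 0 < debt then None
  else if status is Some (k, _) then
    if (tnth m k).1.2 then Some (k, true) else None
  else omap (fun k => (k, false)) [pick k | (tnth m k).2].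
Definition next_lit : bool := (0 < next_debt) || next_status.
Definition next_bright : bool :=
  (0 < next_debt) || (if next_status is Some (_, o) then o else false).

Definition token_transition : token_memory d * option bool * d.-tuple token_message :=
  (Some (inord next_debt, inord ((rotor + departures) %% d), next_status),
   Some next_lit,
   [tuple (inord (served d k rotor departures), next_lit, next_bright) | k < d]).

End Transition.

Definition token_algorithm : algorithm X bool :=
  @Algorithm X bool token_memory (fun _ => None) token_message (ord0, false, false)
    (fun d x z _ m => token_transition x z m).

Section TokenRun.
Variables (n : nat) (N : network n) (x : {ffun 'I_n -> X}).
Notation nb := (neighbors N).
Let c t : configuration token_algorithm N := run token_algorithm N x t.
Let z t i : token_memory (deg N i) := (c t i).1.1.
Let msg t i : (deg N i).-tuple token_message := received (c t) i.

Let D t i := debt (x i) (z t i).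
Let r t i := rotor (z t i).
Let S t i := arrivals (x i) (z t i) (msg t i).
Let flow t i k : nat := (nth (message0 token_algorithm) (c t i).2 k).1.1.
Let st t i :=
  omap (fun p : 'I_(deg N i) * bool => (nth i (nb i) p.1, p.2)) (status (z t.+1 i)).
Let R t i := 0 < D t.+1 i.

Let cS t i : c t.+1 i = token_transition (x i) (z t i) (msg t i).
Proof. by []. Qed.

Let DS t i : D t.+1 i = D t i - S t i.
Proof.
rewrite /D /z cS /= inordK // ltnS /next_debt /debt -/(z t i).
apply: leq_trans (leq_subr _ _) _; case: (z t i) => [[[D' _] _]|].
  by rewrite -ltnS.
exact: leq_bigmax.
Qed.

Let rS t i : r t.+1 i = (r t i + (S t i - D t i)) %% deg N i.
Proof.
by rewrite /r /z cS /= inordK // ltnS ltnW // ltn_pmod // deg_gt0.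
Qed.

Let msgE t i (k : 'I_(deg N i)) :
  tnth (msg t i) k =
  nth (message0 token_algorithm) (c t (nth i (nb i) k)).2 (index i (nb (nth i (nb i) k))).
Proof. exact: (@tnth_received n N X bool token_algorithm (c t) i k). Qed.

Let msg0 i (k : 'I_(deg N i)) : tnth (msg 0 i) k = message0 token_algorithm.
Proof.
rewrite msgE; set j := nth i _ _; set l := index _ _.
have -> : (c 0 j).2 = [tuple message0 token_algorithm | _ < deg N j] by [].
have [lt|ge] := ltnP l (deg N j); last by rewrite nth_default ?size_tuple.
by rewrite (nth_mktuple _ _ (Ordinal lt)).
Qed.

Let msgS t i (k : 'I_(deg N i)) : let j := nth i (nb i) k in
  tnth (msg t.+1 i) k =
  (inord (served (deg N j) (index i (nb j)) (r t j) (S t j - D t j)),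
   lit R st t j, bright R st t j).
Proof.
move=> j; rewrite msgE -/j cS.
have ij : j \in nb i by rewrite mem_nth // size_neighbors.
rewrite (nth_mktuple _ _ (Ordinal (index_neighbors ij))) /=.
have litE : lit R st t j = next_lit (x j) (z t j) (msg t j).
  by rewrite /lit /next_lit /R DS /st /z cS /=; case: next_status.
have brightE : bright R st t j = next_bright (x j) (z t j) (msg t j).
  by rewrite /bright /next_bright /R DS /st /z cS /=; case: next_status => [[]|].
by rewrite litE brightE.
Qed.

Let SS t i : S t.+1 i = \sum_(j <- nb i) flow t.+1 j (index i (nb j)).
Proof.
rewrite /S /arrivals {1}/z cS /= add0n (big_nth i) size_neighbors big_mkord.
by apply: eq_bigr => k _; rewrite msgE.
Qed.

Let S0 i : S 0 i = a (x i).
Proof. by rewrite /S /arrivals /= big1 ?addn0 // => k _; rewrite msg0. Qed.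

Let flowS t i k : k < deg N i ->
  let m := served (deg N i) k (r t i) (S t i - D t i) in
  m <= L -> flow t.+1 i k = m.
Proof.
by move=> kd m mL; rewrite /flow cS /= (nth_mktuple _ _ (Ordinal kd)) /= inordK.
Qed.

Let st0 i : st 0 i = None.
Proof.
rewrite /st /z cS /= /next_status /=; case: ifP => // _.
by case: pickP => // k; rewrite msg0.
Qed.

Let st_source t i : R t i -> st t.+1 i = None.
Proof. by rewrite /R /D /st {2}/z cS /= /next_status => ->. Qed.

Let st_keep t i j o : ~~ R t i -> st t i = Some (j, o) ->
  st t.+1 i = if lit R st t j then Some (j, true) else None.
Proof.
rewrite /R /D {2}/st {2}/z cS /= /next_status => /negPf ->.
rewrite {1}/st; case: status => [[k o']|//] /= [<- _].
by rewrite msgS /=; case: lit.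
Qed.

Let st_adopt t i : ~~ R t i -> st t i = None ->
  if st t.+1 i is Some (j, o) then bright R st t j /\ ~~ o
  else forall j, edge N i j -> ~~ bright R st t j.
Proof.
rewrite /R /D {2}/st {2}/z cS /= /next_status => /negPf ->.
rewrite {1}/st; case: status => //= _.
case: pickP => [k|none] /=; rewrite ?msgS // => j; rewrite -mem_neighbors => ij.
have ki : index j (nb i) < deg N i by rewrite -size_neighbors index_mem.
by have := none (Ordinal ki); rewrite msgS /= nth_index // => /negbT.
Qed.

Let outputE t i : output token_algorithm N x t.+1 i = Some (lit R st t i).
Proof.
rewrite /output -/(c _) cS /lit /R DS /st /z cS /= /next_lit.
by case: next_status.
Qed.

(** The run satisfies the recurrences of the two preceding parts.  The sources are
shifted by one step because the initial messages carry no light. *)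
Lemma token_algorithm_correct :
  terminates_with token_algorithm N x (\sum_i a (x i) < \sum_i b (x i)).
Proof.
have d_gt0 i : 0 < size (nb i) by rewrite size_neighbors deg_gt0.
have aL i : a (x i) <= L by apply: leq_bigmax.
have R_decr t i : R t.+1 i -> R t i.
  by rewrite /R DS => /leq_trans; apply; apply: leq_subr.
have rS' t i : r t.+1 i = (r t i + (S t i - D t i)) %% size (nb i).
  by rewrite size_neighbors rS.
have flowS' t i k : k < size (nb i) ->
  let m := served (size (nb i)) k (r t i) (S t i - D t i) in
  m <= L -> flow t.+1 i k = m by rewrite size_neighbors; apply: flowS.
suff [T litT] : exists T, forall t, T <= t -> forall i,
    lit R st t i = (\sum_i a (x i) < \sum_i b (x i)).
  by exists T.+1 => -[//|t] Tt i; rewrite outputE litT.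
have esym := @edge_sym _ N.
have [ab|ba] := ltnP.
  have [i Di] := @debt_persists _ (edge N) nb esym (mem_neighbors N)
    (neighbors_uniq N) d_gt0 L (a \o x) (b \o x) S D r flow aL S0
    (fun=> erefl) SS DS flowS' ab.
  apply: (@lit_all _ (edge N) esym (edge_connected N) R st R_decr st0 st_source
    st_keep st_adopt).
  by exists i => t; apply: Di.
have [T DT] := @debts_vanish _ (edge N) nb esym (edge_connected N)
  (mem_neighbors N) (neighbors_uniq N) d_gt0 L (a \o x) (b \o x) S D r
  flow aL S0 (fun=> erefl) (fun=> erefl) SS DS rS' flowS' ba.
have [|T' litT'] := @lit_none _ (edge N) R st R_decr st0 st_source st_keep st_adopt.
  by exists T => t Tt i; rewrite /R DT // leqW.
by exists T' => t Tt i; apply/negbTE/litT'.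
Qed.

End TokenRun.
End Threshold.

Lemma computable_sum_lt (X : finType) (a b : X -> nat) :
  computable_family (fun n (x : {ffun 'I_n.+1 -> X}) =>
    (\sum_i a (x i) < \sum_i b (x i))%N).
Proof.
by exists (token_algorithm a b) => n N x; apply: token_algorithm_correct.
Qed.

(** * Running two algorithms side by side *)

Lemma nth_map_default (T1 T2 : Type) (f : T1 -> T2) x0 s k :
  nth (f x0) (map f s) k = f (nth x0 s k).
Proof. by elim: s k => [|x s IHs] [|k] /=. Qed.

Section Product.
Local Open Scope nat_scope.
Variables (X Y1 Y2 Y : finType) (g : Y1 -> Y2 -> Y).
Variables (A : algorithm X Y1) (B : algorithm X Y2).

(** The outputs of the two components belong to the memory, since each transition
reads the previous output of its own component. *)
Definition product_memory (d : nat) : finType :=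
  (memory A d * option Y1 * (memory B d * option Y2))%type.
Definition product_message : finType := (message A * message B)%type.

Definition product_transition (d : nat) (x : X) (z : product_memory d)
    (m : d.-tuple product_message) :
    product_memory d * option Y * d.-tuple product_message :=
  let rA := transition x z.1.1 z.1.2 (map_tuple fst m) in
  let rB := transition x z.2.1 z.2.2 (map_tuple snd m) in
  ((rA.1, rB.1),
   (if (rA.1.2, rB.1.2) is (Some y1, Some y2) then Some (g y1 y2) else None),
   [tuple (tnth rA.2 k, tnth rB.2 k) | k < d]).

Definition product_algorithm : algorithm X Y :=
  @Algorithm X Y product_memory (fun d => (memory0 A d, None, (memory0 B d, None)))
    product_message (message0 A, message0 B)
    (fun d x z _ m => product_transition x z m).

Section ProductRun.
Variables (n : nat) (N : network n) (x : {ffun 'I_n -> X}).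

Lemma product_run t i :
  let c := run product_algorithm N x t i in
  (c.1.1.1, map_tuple fst c.2) = run A N x t i /\
  (c.1.1.2, map_tuple snd c.2) = run B N x t i.
Proof.
elim: t i => [|t IHt] i.
  by split; congr pair; apply: eq_from_tnth => k; rewrite tnth_map !tnth_mktuple.
set c := run product_algorithm N x t.
have recA : map_tuple fst (received c i) = received (run A N x t) i.
  apply: eq_from_tnth => k; rewrite tnth_map tnth_received.
  rewrite (@tnth_received _ _ _ _ product_algorithm).
  by set j := nth i _ _; have [<- _] := IHt j;
    apply/esym/(nth_map_default (@fst _ _) (_, message0 B)).
have recB : map_tuple snd (received c i) = received (run B N x t) i.
  apply: eq_from_tnth => k; rewrite tnth_map tnth_received.
  rewrite (@tnth_received _ _ _ _ product_algorithm).
  by set j := nth i _ _; have [_ <-] := IHt j;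
    apply/esym/(nth_map_default (@snd _ _) (message0 A, _)).
have [IHA IHB] := IHt i.
have stepA : run A N x t.+1 i =
    transition (x i) (c i).1.1.1.1 (c i).1.1.1.2 (map_tuple fst (received c i)).
  by rewrite recA [LHS]/= /step -/(run A N x t) -IHA.
have stepB : run B N x t.+1 i =
    transition (x i) (c i).1.1.2.1 (c i).1.1.2.2 (map_tuple snd (received c i)).
  by rewrite recB [LHS]/= /step -/(run B N x t) -IHB.
rewrite stepA stepB; split; rewrite [RHS]surjective_pairing; congr pair;
  by apply: eq_from_tnth => k; rewrite tnth_map tnth_mktuple.
Qed.

Lemma product_terminates y1 y2 :
  terminates_with A N x y1 -> terminates_with B N x y2 ->
  terminates_with product_algorithm N x (g y1 y2).
Proof.
move=> [T1 out1] [T2 out2]; exists (maxn T1 T2).+1 => -[//|t].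
rewrite ltnS geq_max => /andP[T1t T2t] i.
have := out1 t.+1 (leqW T1t) i; have := out2 t.+1 (leqW T2t) i.
have [runA runB] := product_run t.+1 i.
rewrite /output -runA -runB /= => ->.
by move=> ->.
Qed.

End ProductRun.
End Product.

Lemma computable_family_map2 (X Y1 Y2 Y : finType) (g : Y1 -> Y2 -> Y)
    (f1 : forall n : nat, {ffun 'I_n.+1 -> X} -> Y1)
    (f2 : forall n : nat, {ffun 'I_n.+1 -> X} -> Y2) :
  computable_family f1 -> computable_family f2 ->
  computable_family (fun n x => g (f1 n x) (f2 n x)).
Proof.
move=> [A cA] [B cB]; exists (product_algorithm g A B) => n N x.
exact: product_terminates.
Qed.

Lemma computable_family_cst (X Y : finType) (y : Y) :
  computable_family (fun n (x : {ffun 'I_n.+1 -> X}) => y).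
Proof.
exists (@Algorithm X Y (fun _ => unit) (fun _ => tt) unit tt
  (fun d _ z _ m => (z, Some y, m))) => n N x.
by exists 1 => -[].
Qed.

Lemma eq_computable_family (X Y : finType)
    (f1 f2 : forall n : nat, {ffun 'I_n.+1 -> X} -> Y) :
  (forall n x, f1 n x = f2 n x) -> computable_family f1 -> computable_family f2.
Proof. by move=> f12 [A cA]; exists A => n N x; rewrite -f12. Qed.

Import Order.TTheory GRing.Theory Num.Theory.

Local Open Scope classical_set_scope.
Local Open Scope ring_scope.

(** * Computable functions of the frequencies *)

Definition rat_box (d : nat) : Type := ('rV[rat]_d * 'rV[rat]_d)%type.

Section Computable.
Variables (R : realType) (K : nat).
Implicit Types (Y : finType).

Lemma eq_computable Y (h1 h2 : simplex R K -> Y) :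
  h1 =1 h2 -> computable h1 -> computable h2.
Proof. by move=> h12; apply: eq_computable_family => n x; rewrite h12. Qed.

Lemma computable_map2 (Y1 Y2 Y : finType) (g : Y1 -> Y2 -> Y)
    (h1 : simplex R K -> Y1) (h2 : simplex R K -> Y2) :
  computable h1 -> computable h2 -> computable (fun p => g (h1 p) (h2 p)).
Proof. exact: computable_family_map2. Qed.

Lemma computable_cst Y (y : Y) : computable (fun _ : simplex R K => y).
Proof. exact: computable_family_cst. Qed.

Lemma computable_if Y (P : simplex R K -> bool) (f g : simplex R K -> Y) :
  computable P -> computable f -> computable g ->
  computable (fun p => if P p then f p else g p).
Proof.
move=> cP cf cg; have cfg := computable_map2 (@pair _ _) cf cg.
exact: (computable_map2 (fun (b : bool) (u : Y * Y) => if b then u.1 else u.2) cP cfg).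
Qed.

Lemma computable_forall (I : finType) (P : I -> simplex R K -> bool) :
  (forall k, computable (P k)) -> computable (fun p => [forall k, P k p]).
Proof.
move=> cP; apply: (@eq_computable _ (fun p => all (P^~ p) (enum I))).
  by move=> p; apply/allP/forallP => [all_P k|all_P k _]; rewrite ?all_P ?mem_enum.
elim: (enum I) => [|k s IHs]; first exact: computable_cst.
exact: (computable_map2 andb (cP k) IHs).
Qed.

Lemma ltr_nat_ratio (a b c d : nat) : (0 < b)%N -> (0 < d)%N ->
  ((a%:R / b%:R : R) < c%:R / d%:R) = (a * d < c * b)%N.
Proof.
move=> b0 d0; rewrite ltr_pdivrMr ?ltr0n // mulrAC ltr_pdivlMr ?ltr0n //.
by rewrite -!natrM ltr_nat.
Qed.

Lemma sum_indicator n (x : {ffun 'I_n.+1 -> 'I_K.+1}) k (d : nat) :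
  (\sum_i (x i == k) * d = #|[pred i | x i == k]| * d)%N.
Proof.
by rewrite -big_distrl /= -sum1_card [in RHS]big_mkcond; congr (_ * _)%N.
Qed.

Variant ratr_spec (q : rat) : Prop :=
| NegRat of (ratr q : R) < 0
| NonnegRat (c d : nat) of (0 < d)%N & ratr q = c%:R / d%:R :> R.

Lemma ratrP q : ratr_spec q.
Proof.
have [q0|q0] := ltP q 0; first by apply: NegRat; rewrite ltrq0.
apply: (@NonnegRat _ `|numq q|%N `|denq q|%N); first by rewrite absz_gt0 denq_neq0.
rewrite /ratr; congr (_ / _).
  by rewrite -[in LHS](gez0_abs (_ : 0 <= numq q)) ?numq_ge0.
by rewrite -[in LHS](gez0_abs (ltW (denq_gt0 q))).
Qed.

Lemma coord_ge0 (p : simplex R K) k : 0 <= val p 0 k.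
Proof. by case: p => p /= /andP[/forallP /(_ k) /andP[]]. Qed.

(** For [q = c / d], the test [p_k < q] compares [d] tokens per node with value
[k] against a debt [c] per node. *)
Lemma computable_lt_coord (q : rat) (k : 'I_K.+1) :
  computable (fun p : simplex R K => val p 0 k < ratr q).
Proof.
case: (ratrP q) => [q0|c d d0 qE].
  apply: eq_computable (computable_cst false) => p /=.
  by apply/esym/negbTE; rewrite -leNgt (le_trans (ltW q0)) ?coord_ge0.
apply: eq_computable_family (computable_sum_lt (fun y => (y == k) * d)%N (fun=> c)).
move=> n x /=; rewrite mxE qE ltr_nat_ratio // sum_indicator sum_nat_const card_ord.
by rewrite [(_ * c)%N]mulnC.
Qed.

Lemma computable_gt_coord (q : rat) (k : 'I_K.+1) :
  computable (fun p : simplex R K => ratr q < val p 0 k).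
Proof.
case: (ratrP q) => [q0|c d d0 qE].
  apply: eq_computable (computable_cst true) => p /=.
  by apply/esym; rewrite (lt_le_trans q0) ?coord_ge0.
apply: eq_computable_family (computable_sum_lt (fun=> c) (fun y => (y == k) * d)%N).
move=> n x /=; rewrite mxE qE ltr_nat_ratio // sum_indicator sum_nat_const card_ord.
by rewrite [(_ * c)%N]mulnC.
Qed.

Definition in_rat_box (B : rat_box K) (q : 'rV[R]_K) : bool :=
  [forall k, ratr (B.1 0 k) < q 0 k < ratr (B.2 0 k)].

Lemma computable_in_rat_box B :
  computable (fun p : simplex R K => in_rat_box B (simplex_chart p)).
Proof.
apply: computable_forall => k.
have := computable_map2 andb (computable_gt_coord (B.1 0 k) (lift ord0 k))
  (computable_lt_coord (B.2 0 k) (lift ord0 k)).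
by apply: eq_computable => p; rewrite mxE.
Qed.

End Computable.

(** * The algebra of box functions *)

Section BoxFunctions.
Variables (R : realType) (K : nat).
Implicit Types (h f g : simplex R K -> R).

Definition box_sum (s : seq (R * rat_box K.+1)) (p : simplex R K) : R :=
  \sum_(t <- s) t.1 * \1_(rational_open_box t.2.1 t.2.2) (val p).

Lemma box_functionP h : box_function h <-> exists s, h =1 box_sum s.
Proof.
split=> [[m [c [a [b hE]]]]|[s hE]].
  exists [seq (c i, (a i, b i)) | i <- enum 'I_m] => p.
  by rewrite /box_sum big_map big_enum hE.
exists (size s), (fun i => (tnth (in_tuple s) i).1),
  (fun i => (tnth (in_tuple s) i).2.1), (fun i => (tnth (in_tuple s) i).2.2) => p.
by rewrite hE /box_sum big_tnth.
Qed.

Lemma eq_box_function h1 h2 : h1 =1 h2 -> box_function h1 -> box_function h2.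
Proof. by move=> h12 [m [c [a [b hE]]]]; exists m, c, a, b => p; rewrite -h12 hE. Qed.

Lemma box_functionD f g :
  box_function f -> box_function g -> box_function (fun p => f p + g p).
Proof.
move=> /box_functionP[s fE] /box_functionP[t gE]; apply/box_functionP.
by exists (s ++ t) => p; rewrite /box_sum big_cat fE gE.
Qed.

Lemma rational_open_boxI (a b a' b' : 'rV[rat]_K.+1) :
  rational_open_box a b `&` rational_open_box a' b' =
  rational_open_box (\row_k Num.max (a 0 k) (a' 0 k)) (\row_k Num.min (b 0 k) (b' 0 k))
  :> set 'rV[R]_K.+1.
Proof.
apply/seteqP; split => p /=.
  move=> [ab a'b'] k; rewrite !mxE.
  have /andP[ap pb] := ab k; have /andP[a'p pb'] := a'b' k.
  by rewrite maxEle minEle; case: ifP => _; case: ifP => _; rewrite ?ap ?a'p ?pb ?pb'.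
move=> abp; split=> k; have := abp k; rewrite !mxE => /andP[ap pb]; apply/andP; split.
- by apply: le_lt_trans ap; rewrite ler_rat le_max lexx.
- by apply: lt_le_trans pb _; rewrite ler_rat ge_min lexx.
- by apply: le_lt_trans ap; rewrite ler_rat le_max lexx orbT.
- by apply: lt_le_trans pb _; rewrite ler_rat ge_min lexx orbT.
Qed.

Lemma box_functionM f g :
  box_function f -> box_function g -> box_function (fun p => f p * g p).
Proof.
move=> /box_functionP[s fE] /box_functionP[t gE]; apply/box_functionP.
pose cap (B C : rat_box K.+1) : rat_box K.+1 :=
  (\row_k Num.max (B.1 0 k) (C.1 0 k), \row_k Num.min (B.2 0 k) (C.2 0 k)).
exists [seq (u.1 * v.1, cap u.2 v.2) | u <- s, v <- t] => p.
rewrite /box_sum big_allpairs_dep fE gE /box_sum big_distrl /=; apply: eq_bigr => u _.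
rewrite big_distrr /=; apply: eq_bigr => v _.
by rewrite -rational_open_boxI indicI /= mulrACA.
Qed.

Lemma coord_le1 (p : simplex R K) k : val p 0 k <= 1.
Proof. by case: p => p /= /andP[/forallP /(_ k) /andP[]]. Qed.

Lemma box_function_indicator (a b : 'rV[rat]_K.+1) :
  box_function (fun p : simplex R K => \1_(rational_open_box a b) (val p)).
Proof.
apply/box_functionP; exists [:: (1, (a, b))] => p.
by rewrite /box_sum big_seq1 mul1r.
Qed.

(** The simplex lies in an open box with rational corners. *)
Lemma box_function_cst c : box_function (fun _ : simplex R K => c).
Proof.
apply/box_functionP; exists [:: (c, (const_mx (-1), const_mx 2))] => p.
rewrite /box_sum big_seq1 indicE mem_set ?mulr1 // => k /=.
have := coord_ge0 p k; have := coord_le1 p k.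
rewrite !mxE rmorphN rmorph1 rmorph_nat; lra.
Qed.

Lemma box_function_if (P : simplex R K -> bool) f g :
  box_function (fun p => (P p)%:R) -> box_function f -> box_function g ->
  box_function (fun p => if P p then f p else g p).
Proof.
move=> bP bf bg.
have bNP := box_functionD (box_function_cst 1) (box_functionM (box_function_cst (-1)) bP).
apply: eq_box_function (box_functionD (box_functionM bP bf) (box_functionM bNP bg)).
by move=> p /=; case: (P p) => /=; ring.
Qed.

(** A box of the chart becomes a box of the ambient space by leaving the forgotten
coordinate [p_0] unconstrained within the simplex. *)
Lemma box_function_in_rat_box (B : rat_box K) :
  box_function (fun p : simplex R K => (in_rat_box B (simplex_chart p))%:R).
Proof.
pose ext (c : rat) (v : 'rV[rat]_K) : 'rV[rat]_K.+1 :=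
  \row_k oapp (v 0) c (unlift ord0 k).
apply: eq_box_function (box_function_indicator (ext (-1) B.1) (ext 2 B.2)) => p.
rewrite indicE; congr ((nat_of_bool _)%:R); apply/idP/idP => [|/forallP inB].
  rewrite inE => inB; apply/forallP => k; have := inB (lift ord0 k).
  by rewrite !mxE liftK.
rewrite inE => k; case: (unliftP ord0 k) => [j ->|->]; rewrite !mxE ?liftK ?unlift_none /=.
  by have := inB j; rewrite mxE.
have := coord_ge0 p ord0; have := coord_le1 p ord0.
rewrite rmorphN rmorph1 rmorph_nat; lra.
Qed.

End BoxFunctions.

(** * Decision lists over finite unions of boxes *)

Section Selection.
Variables (R : realType) (K : nat).

Definition in_union (l : seq (rat_box K)) (q : 'rV[R]_K) : bool :=
  has (fun B => in_rat_box B q) l.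

Lemma computable_in_union l :
  computable (fun p : simplex R K => in_union l (simplex_chart p)).
Proof.
elim: l => [|B l IHl]; first exact: computable_cst.
exact: (computable_map2 orb (computable_in_rat_box R B) IHl).
Qed.

Lemma box_function_in_union l :
  box_function (fun p : simplex R K => (in_union l (simplex_chart p))%:R).
Proof.
elim: l => [|B l IHl]; first exact: box_function_cst.
have := box_function_if (box_function_in_rat_box R B) (box_function_cst K 1) IHl.
apply: eq_box_function => p /=.
by case: in_rat_box.
Qed.

Variables (Y : {fset R}) (y0 : Y) (U : Y -> seq (rat_box K)).

Definition select (s : seq Y) (q : 'rV[R]_K) : Y :=
  foldr (fun y z => if in_union (U y) q then y else z) y0 s.

Lemma computable_select s :
  computable (fun p : simplex R K => select s (simplex_chart p)).
Proof.
elim: s => [|y s IHs]; first exact: computable_cst.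
by apply: computable_if (computable_in_union _) (computable_cst _ _ _) IHs.
Qed.

Lemma box_function_select s :
  box_function (fun p : simplex R K => val (select s (simplex_chart p))).
Proof.
elim: s => [|y s IHs]; first exact: box_function_cst.
have := box_function_if (box_function_in_union (U y)) (box_function_cst K (val y)) IHs.
apply: eq_box_function => p /=.
by case: in_union.
Qed.

End Selection.

(** * Lebesgue outer measure *)

Section LebesgueOuter.
Local Open Scope ereal_scope.
Variables (R : realType) (d : nat).
Implicit Types (A : set 'rV[R]_d) (a b : 'rV[R]_d).
Local Notation mu := (@lebesgue_outer R d).

Lemma box_volume_ge0 a b : (0 <= box_volume a b)%R.
Proof. by apply: prodr_ge0 => k _; rewrite le_max lexx. Qed.

Lemma lebesgue_outer_le A (I : set nat) (a b : nat -> 'rV[R]_d) :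
  A `<=` \bigcup_(i in I) oc_box (a i) (b i) ->
  mu A <= \esum_(i in I) (box_volume (a i) (b i))%:E.
Proof. by move=> AI; apply: ereal_inf_lbound; exists I, a, b. Qed.

Lemma lebesgue_outer_approx A (e : R) : (0 < e)%R -> mu A != +oo ->
  exists (I : set nat) (a b : nat -> 'rV[R]_d),
    A `<=` \bigcup_(i in I) oc_box (a i) (b i) /\
    \esum_(i in I) (box_volume (a i) (b i))%:E <= mu A + e%:E.
Proof.
move=> e0 Aoo.
have [|_ /= [I [a [b [AI ->]]]] le] :=
    @lb_ereal_inf_adherent _ _ e e0 (_ : mu A \is a fin_num).
  rewrite ge0_fin_numE ?ltey //; apply: le_ereal_inf_tmp => _ [I [a [b [_ ->]]]].
  by apply: esum_ge0 => i _; rewrite lee_fin box_volume_ge0.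
by exists I, a, b; split => //; apply: ltW.
Qed.

Lemma lebesgue_outer_ge0 A : 0 <= mu A.
Proof.
apply: le_ereal_inf_tmp => _ [I [a [b [_ ->]]]].
by apply: esum_ge0 => i _; rewrite lee_fin box_volume_ge0.
Qed.

Lemma lebesgue_outer0 : mu set0 = 0.
Proof.
apply/eqP; rewrite eq_le lebesgue_outer_ge0 andbT.
by rewrite -(esum_set0 (fun i : nat => (@box_volume R d 0%R 0%R)%:E)) lebesgue_outer_le.
Qed.

Lemma le_lebesgue_outer : {homo mu : A B / A `<=` B >-> A <= B}.
Proof.
move=> A B AB; apply: ereal_inf_le_tmp => v [I [a [b [BI ->]]]].
by exists I, a, b; split => //; apply: subset_trans BI.
Qed.

(** Covers of the sets with total excess [e], indexed by pairs of numbers, are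
merged into one cover through an encoding of pairs. *)
Lemma lebesgue_outer_sigma_subadditive : sigma_subadditive mu.
Proof.
move=> A; have [[i ioo]|noo] := pselect (exists i, mu (A i) = +oo).
  rewrite (eseries_pinfty _ _ ioo) ?leey// => n _.
  by rewrite -ltNye (lt_le_trans _ (lebesgue_outer_ge0 _)).
apply/lee_addgt0Pr => e e0.
apply: le_trans (epsilon_trick xpredT (fun n => lebesgue_outer_ge0 (A n)) (ltW e0)).
have [C PC] : {C : nat -> set nat * (nat -> 'rV[R]_d) * (nat -> 'rV[R]_d) & forall n,
    A n `<=` \bigcup_(i in (C n).1.1) oc_box ((C n).1.2 i) ((C n).2 i) /\
    \esum_(i in (C n).1.1) (box_volume ((C n).1.2 i) ((C n).2 i))%:E <=
      mu (A n) + (e / (2 ^ n.+1)%:R)%:E}.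
  apply: (@choice _ _ (fun n C => A n `<=` \bigcup_(i in C.1.1) oc_box (C.1.2 i) (C.2 i) /\
    \esum_(i in C.1.1) (box_volume (C.1.2 i) (C.2 i))%:E <=
      mu (A n) + (e / (2 ^ n.+1)%:R)%:E)) => n.
  have [||I [a [b [AI le]]]] := @lebesgue_outer_approx (A n) (e / (2 ^ n.+1)%:R).
  - by rewrite divr_gt0 // ltr0n expn_gt0.
  - by apply/eqP => Aoo; apply: noo; exists n.
  - by exists (I, a, b).
pose J := [set: nat] `*`` (fun n => (C n).1.1).
pose dec (k : nat) : nat * nat := odflt (0, 0)%N (@choice.unpickle (nat * nat)%type k).
have decK : cancel (@choice.pickle (nat * nat)%type) dec.
  by move=> k; rewrite /dec choice.pickleK.
have AI : \bigcup_n A n `<=` \bigcup_(k in @choice.pickle (nat * nat)%type @` J)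
    oc_box ((C (dec k).1).1.2 (dec k).2) ((C (dec k).1).2 (dec k).2).
  move=> p [n _ /(PC n).1 [i ni ip]].
  exists (@choice.pickle (nat * nat)%type (n, i)); last by rewrite decK.
  by exists (n, i).
apply: le_trans (lebesgue_outer_le AI) _.
rewrite esum_image; last by move=> i j _ _; apply: (can_inj decK).
under eq_esum do rewrite decK.
rewrite -(@esum_esum _ _ _ setT (fun n => (C n).1.1)
  (fun n i => (box_volume ((C n).1.2 i) ((C n).2 i))%:E)); last first.
  by move=> n i _ _; rewrite lee_fin box_volume_ge0.
rewrite -nneseries_esumT => [|n]; last first.
  by apply: esum_ge0 => i _; rewrite lee_fin box_volume_ge0.
apply: lee_nneseries => n _; last by apply: (PC n).2.
by move=> _; apply: esum_ge0 => i _; rewrite lee_fin box_volume_ge0.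
Qed.

HB.instance Definition _ := isOuterMeasure.Build R 'rV[R]_d mu lebesgue_outer0
  lebesgue_outer_ge0 le_lebesgue_outer lebesgue_outer_sigma_subadditive.

Definition set_coord (a : 'rV[R]_d) k c : 'rV[R]_d :=
  (\row_j if j == k then c else a 0 j)%R.

Lemma box_volume_split a b k (c : R) :
  (box_volume a (set_coord b k (Num.min (b 0 k) c)) +
   box_volume (set_coord a k (Num.max (a 0 k) c)) b = box_volume a b)%R.
Proof.
rewrite /box_volume (bigD1 k) //= [X in (_ + X)%R](bigD1 k) //= [in RHS](bigD1 k) //=.
rewrite !mxE eqxx.
set P := (\prod_(i | i != k) Num.max 0 (b 0 i - a 0 i))%R.
rewrite [X in (_ * X + _)%R](_ : _ = P); last first.
  by apply: eq_bigr => i /negPf ik; rewrite !mxE ik.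
rewrite [X in (_ + _ * X)%R](_ : _ = P); last first.
  by apply: eq_bigr => i /negPf ik; rewrite !mxE ik.
rewrite -mulrDl; congr (_ * _)%R.
move: (a 0 k)%R (b 0 k)%R => x y; rewrite !maxEle !minEle.
by repeat (case: ifP => //); lra.
Qed.

(** A half-space cuts every box of a cover into two boxes whose volumes add up. *)
Lemma caratheodory_halfspace k (c : R) : mu.-caratheodory [set q : 'rV[R]_d | (q 0 k <= c)%R].
Proof.
apply: le_caratheodory_measurable => X /=.
apply: le_ereal_inf_tmp => _ [I [a [b [XI ->]]]].
under eq_esum do rewrite -(box_volume_split _ _ k c) EFinD.
rewrite esumD; last 2 first.
- by move=> i _; rewrite lee_fin box_volume_ge0.
- by move=> i _; rewrite lee_fin box_volume_ge0.
apply: leeD; apply: lebesgue_outer_le => q [/XI[i Ii abq] /= qc]; exists i => // j;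
  rewrite mxE; case: eqP => [->|_]; try exact: abq.
- by have /andP[-> qb] := abq k; rewrite le_min qb.
- by have /andP[aq ->] := abq k; rewrite gt_max aq ltNge; move/negP: qc => ->.
Qed.

Lemma caratheodory_lt k (c : R) : mu.-caratheodory [set q : 'rV[R]_d | (q 0 k < c)%R].
Proof.
rewrite (_ : [set q | _] = \bigcup_n [set q : 'rV[R]_d | (q 0 k <= c - n.+1%:R^-1)%R]).
  by apply: caratheodory_measurable_bigcup => n; apply: caratheodory_halfspace.
apply/seteqP; split => q /= => [qc|[n _ /= qc]]; last first.
  by apply: le_lt_trans qc _; rewrite ltrBlDr ltrDl invr_gt0 ltr0n.
have cq : (0 < c - q 0 k)%R by rewrite subr_gt0.
exists (Num.truncn (c - q 0 k)^-1)%R => //=; rewrite lerBrDl -lerBrDr.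
rewrite -[leRHS]invrK lef_pV2 ?posrE ?invr_gt0 // ?ltr0n //.
by apply/ltW/truncnS_gt.
Qed.

Lemma caratheodory_in_rat_box (B : rat_box d) :
  mu.-caratheodory [set q : 'rV[R]_d | in_rat_box B q].
Proof.
rewrite (_ : [set q | _] = [set q : 'rV[R]_d |
   all (fun k => ratr (B.1 0 k) < q 0 k < ratr (B.2 0 k))%R (enum 'I_d)]); last first.
  apply/seteqP; split => q /= => [/forallP Bq|/allP Bq]; first by apply/allP.
  by apply/forallP => k; apply: Bq; rewrite mem_enum.
elim: (enum 'I_d) => [|k s IHs] /=.
  rewrite (_ : [set q | _] = ~` set0); last by apply/seteqP; split => // q _ [].
  by apply: caratheodory_measurable_setC; apply: caratheodory_measurable_set0.
rewrite (_ : [set q | _] = (~` [set q : 'rV[R]_d | (q 0 k <= ratr (B.1 0 k))%R] `&`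
    [set q : 'rV[R]_d | (q 0 k < ratr (B.2 0 k))%R]) `&`
    [set q : 'rV[R]_d | all (fun k => ratr (B.1 0 k) < q 0 k < ratr (B.2 0 k))%R s]).
  apply: caratheodory_measurable_setI IHs; apply: caratheodory_measurable_setI.
    by apply: caratheodory_measurable_setC; apply: caratheodory_halfspace.
  exact: caratheodory_lt.
apply/seteqP; split => q /= => [/andP[/andP[aq qb] all_q]|[[/negP aq qb] all_q]].
  by split => //; split => //; apply/negP; rewrite -ltNge.
by rewrite qb all_q !andbT ltNge.
Qed.

Lemma caratheodory_in_union (l : seq (rat_box d)) :
  mu.-caratheodory [set q : 'rV[R]_d | in_union l q].
Proof.
elim: l => [|B l IHl] /=.
  rewrite (_ : [set q | _] = set0); last by apply/seteqP; split => q /=.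
  exact: caratheodory_measurable_set0.
rewrite (_ : [set q | _] =
  [set q : 'rV[R]_d | in_rat_box B q] `|` [set q : 'rV[R]_d | in_union l q]).
  by apply: caratheodory_measurable_setU IHl; apply: caratheodory_in_rat_box.
by apply/seteqP; split => q /= => [/orP|] // [->|->]; rewrite ?orbT.
Qed.

End LebesgueOuter.

(** * Approximation by finite unions of rational boxes *)

Section Approximation.
Local Open Scope ereal_scope.
Variables (R : realType) (d : nat).
Local Notation mu := (@lebesgue_outer R d).

(** Continuity of a product in its factors, all enlarged by the same amount; here
the factors are the side lengths of a box. *)
Lemma prod_enlarge (I : Type) (s : seq I) (x : I -> R) (e : R) :
  (forall i, 0 <= x i)%R -> (0 < e)%R ->
  exists2 t : R, (0 < t)%R & (\prod_(i <- s) (x i + t) <= \prod_(i <- s) x i + e)%R.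
Proof.
move=> x0; elim: s e => [|i s IHs] e e0.
  by exists 1%R => //; rewrite !big_nil lerDl ltW.
have xi1 : (0 < x i + 1)%R by rewrite ltr_wpDl.
pose w := (e / 2 / (x i + 1))%R.
have w0 : (0 < w)%R by rewrite !divr_gt0.
have wE : (w * (x i + 1) = e / 2)%R by rewrite divfK ?gt_eqF.
have [t t0] := IHs _ w0; set P := (\prod_(j <- s) x j)%R => le_t.
have P0 : (0 <= P)%R by apply: prodr_ge0.
have Pw : (0 < P + w)%R by rewrite ltr_wpDl.
pose u := Num.min t (e / 2 / (P + w))%R.
have u0 : (0 < u)%R by rewrite lt_min t0 !divr_gt0.
have le_u : (\prod_(j <- s) (x j + u) <= P + w)%R.
  apply: le_trans le_t; apply: ler_prod => j _.
  apply/andP; split; first by rewrite addr_ge0 // ltW.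
  by rewrite lerD2l ge_min lexx.
have uPw : (u * (P + w) <= e / 2)%R by rewrite -ler_pdivlMr // ge_min lexx orbT.
exists u => //; rewrite !big_cons -/P.
apply: le_trans (ler_wpM2l (addr_ge0 (x0 i) (ltW u0)) le_u) _.
have := x0 i; nra.
Qed.

Definition rat_box_volume (B : rat_box d) : R :=
  box_volume (map_mx ratr B.1) (map_mx ratr B.2).

Lemma rat_enlarge (a b : 'rV[R]_d) (e : R) : (0 < e)%R ->
  exists B : rat_box d,
    oc_box a b `<=` [set q | in_rat_box B q] /\
    (rat_box_volume B <= box_volume a b + e)%R.
Proof.
move=> e0.
have [k|t t0 le_t] := @prod_enlarge _ (enum 'I_d)
    (fun k => Num.max 0 (b 0 k - a 0 k))%R e _ e0; first by rewrite le_max lexx.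
have ratlt (x y : R) : (x < y)%R -> exists q : rat, (x < ratr q < y)%R.
  by move=> /rat_in_itvoo[q]; rewrite in_itv; exists q.
have /choice[f fP] k : exists q : rat, (a 0%R k - t / 2 < ratr q < a 0%R k)%R.
  by apply: ratlt; rewrite ltrBlDr ltrDl divr_gt0.
have /choice[g gP] k : exists q : rat, (b 0%R k < ratr q < b 0%R k + t / 2)%R.
  by apply: ratlt; rewrite ltrDl divr_gt0.
exists ((\row_k f k)%R, (\row_k g k)%R); split.
  move=> q abq; apply/forallP => k; rewrite !mxE /=.
  have /andP[aq qb] := abq k; have /andP[_ fa] := fP k; have /andP[bg _] := gP k.
  by rewrite (lt_trans fa aq) (le_lt_trans qb bg).
rewrite !big_enum in le_t; apply: le_trans le_t; apply: ler_prod => k _.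
rewrite le_max lexx /= !mxE /=.
have /andP[af fa] := fP k; have /andP[bg gb] := gP k.
rewrite !maxEle; repeat case: ifP; lra.
Qed.

Lemma lebesgue_outer_rat_box (B : rat_box d) :
  mu [set q : 'rV[R]_d | in_rat_box B q] <= (rat_box_volume B)%:E.
Proof.
rewrite -(@esum_set1 _ _ 0%N (fun i : nat => (rat_box_volume B)%:E)); last first.
  by rewrite lee_fin box_volume_ge0.
apply: (@lebesgue_outer_le R d _ [set 0%N] (fun=> map_mx ratr B.1) (fun=> map_mx ratr B.2)).
move=> q /forallP Bq; exists 0%N => // k; rewrite !mxE.
by have /andP[-> /ltW] := Bq k.
Qed.

(** Let [V] be the rational boxes enlarging a nearly optimal cover of [A], and [u]
their volumes.  What finitely many [V n] miss of [A] lies in the others, so it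
is bounded by a tail of the convergent series [u].  What they add to [A] is
bounded by Caratheodory's condition on [A] tested on the union of all [V n]. *)
Lemma caratheodory_approx (A : set 'rV[R]_d) (e : R) : (0 < e)%R ->
  mu.-caratheodory A -> mu A != +oo ->
  exists l : seq (rat_box d),
    mu (A `\` [set q | in_union l q]) <= e%:E /\
    mu ([set q | in_union l q] `\` A) <= e%:E.
Proof.
move=> e0 mA Aoo; have e20 : (0 < e / 2)%R by rewrite divr_gt0.
have Afin : mu A \is a fin_num by rewrite ge0_fin_numE ?ltey ?lebesgue_outer_ge0.
have [I [a [b [AI le_e]]]] := lebesgue_outer_approx e20 Aoo.
have e2n n : (0 < e / 2 / (2 ^ n.+1)%:R)%R by rewrite divr_gt0 // ltr0n expn_gt0.
have [B PB] := choice (fun n => rat_enlarge (a n) (b n) (e2n n)).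
pose V n := [set q : 'rV[R]_d | I n /\ in_rat_box (B n) q].
pose u n : \bar R := if n \in I then (rat_box_volume (B n))%:E else 0.
have u0 n : 0 <= u n by rewrite /u; case: ifP => // _; rewrite lee_fin box_volume_ge0.
have Vu n : mu (V n) <= u n.
  rewrite /u; case: ifPn => [In|nIn].
    by apply: le_trans (lebesgue_outer_rat_box _); apply: le_lebesgue_outer => q [].
  rewrite (_ : V n = set0) ?lebesgue_outer0 //.
  by apply/seteqP; split => // q [In _]; case/negP: nIn; rewrite inE.
have AV : A `<=` \bigcup_n V n.
  move=> q /AI[n In abq]; exists n => //; split => //.
  exact: (PB n).1.
have sum_u : \sum_(n <oo) u n <= mu A + e%:E.
  pose v n : \bar R := if n \in I then (box_volume (a n) (b n))%:E else 0.
  have v0 n : 0 <= v n by rewrite /v; case: ifP => // _; rewrite lee_fin box_volume_ge0.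
  apply: le_trans (_ : \sum_(n <oo) (v n + (e / 2 / (2 ^ n.+1)%:R)%:E) <= _).
    apply: lee_nneseries => // n _; rewrite /u /v; case: ifP => _.
      by rewrite -EFinD lee_fin; apply: (PB n).2.
    by rewrite add0e lee_fin ltW.
  apply: le_trans (epsilon_trick xpredT v0 (ltW e20)) _.
  rewrite [e in X in _ <= X]splitr EFinD addeA leeD2r //.
  by rewrite nneseries_esumT // /v -esum_mkcond.
have sum_fin : \sum_(n <oo) u n < +oo.
  apply: le_lt_trans sum_u _; rewrite -ge0_fin_numE ?fin_numD ?Afin //.
  by rewrite adde_ge0 ?lebesgue_outer_ge0 ?lee_fin ?ltW.
have := nneseries_tail_cvg sum_fin (fun n _ => u0 n).
move=> /fine_cvgP[tail_fin /cvgrPdist_le /(_ e e0) tail_le].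
have [N _ tailN] := filterI tail_fin tail_le.
have [Nfin Nle] := tailN N (leqnn N).
pose l := [seq B n | n <- iota 0 N & n \in I].
have lV q : in_union l q <-> exists2 n, (n < N)%N & V n q.
  rewrite /in_union /l; split.
    move=> /hasP[C /mapP[n]]; rewrite mem_filter mem_iota => /andP[/set_mem In nN] -> Bq.
    by exists n.
  move=> [n nN [In Bq]]; apply/hasP; exists (B n) => //; apply/mapP; exists n => //.
  by rewrite mem_filter (mem_set In) mem_iota.
exists l; split.
  apply: le_trans (_ : mu (\bigcup_(n in ~` `I_N) V n) <= _).
    apply: le_lebesgue_outer => q [/AV[n _ Vq] nl]; exists n => //= nN.
    by apply: nl; apply/lV; exists n.
  apply: le_trans (outer_measure_sigma_subadditive_tail mu N V) _.
  apply: le_trans (_ : \sum_(N <= n <oo) u n <= _); first by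
    apply: lee_nneseries => n *; [exact: lebesgue_outer_ge0|exact: Vu].
  rewrite -(fineK Nfin) lee_fin; apply: le_trans Nle.
  by rewrite sub0r normrN ler_norm.
apply: le_trans (_ : mu ((\bigcup_n V n) `\` A) <= _).
  by apply: le_lebesgue_outer => q [/lV[n _ Vq] nA]; split => //; exists n.
have := mA (\bigcup_n V n); rewrite setIidr // -setDE => muV.
have : mu A + mu (\bigcup_n V n `\` A) <= mu A + e%:E.
  rewrite -muV; apply: le_trans (lebesgue_outer_sigma_subadditive V) _.
  apply: le_trans sum_u.
  by apply: lee_nneseries => n *; [exact: lebesgue_outer_ge0|exact: Vu].
by rewrite leeD2lE.
Qed.

End Approximation.

(** * The decision list of a measurable function *)

Section DecisionList.
Variables (R : realType) (K : nat).
Local Notation mu := (@lebesgue_outer R K).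

(** The forgotten coordinate is determined by the sum condition. *)
Lemma simplex_chart_inj : injective (@simplex_chart R K).
Proof.
move=> p q pq; apply: val_inj; apply/rowP => k.
have pqE j : val p 0 (lift ord0 j) = val q 0 (lift ord0 j).
  by have /rowP/(_ j) := pq; rewrite !mxE.
case: (unliftP ord0 k) => [j|] ->; first exact: pqE.
case/andP: (valP p) => _ /eqP; case/andP: (valP q) => _ /eqP <-.
rewrite !big_ord_recl; under eq_bigr do rewrite pqE.
by move=> /addIr.
Qed.

Lemma chart_image_finite (A : set (simplex R K)) :
  (mu (@simplex_chart R K @` A) != +oo)%E.
Proof.
pose B : rat_box K := (const_mx (-1), const_mx 2).
rewrite -ltey; apply: le_lt_trans (ltry (rat_box_volume R B)).
apply: le_trans (lebesgue_outer_rat_box R B); apply: le_lebesgue_outer => _ [p _ <-].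
apply/forallP => k; have := coord_ge0 p (lift ord0 k); have := coord_le1 p (lift ord0 k).
rewrite !mxE rmorphN rmorph1 rmorph_nat; lra.
Qed.

Lemma lebesgue_outer_bigsetU (I : Type) (s : seq I) (F : I -> set 'rV[R]_K) :
  (mu (\big[setU/set0]_(i <- s) F i) <= \sum_(i <- s) mu (F i))%E.
Proof.
elim: s => [|i s IHs]; first by rewrite !big_nil lebesgue_outer0.
rewrite !big_cons; apply: le_trans (outer_measureU2 mu _ _) _.
by rewrite leeD2l.
Qed.

Variables (Y : {fset R}) (y0 : Y) (U : Y -> seq (rat_box K)).

Lemma caratheodory_select s y :
  mu.-caratheodory [set q : 'rV[R]_K | select y0 U s q = y].
Proof.
elim: s => [|y' s IHs] /=.
  case: (eqVneq y0 y) => [->|/eqP ne].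
    rewrite (_ : [set q | _] = ~` set0); last by apply/seteqP; split => // q _ [].
    by apply: caratheodory_measurable_setC; apply: caratheodory_measurable_set0.
  rewrite (_ : [set q | _] = set0); last by apply/seteqP; split => q.
  exact: caratheodory_measurable_set0.
have := @caratheodory_in_union R K (U y').
case: (eqVneq y' y) => [->|/eqP ne] mU.
  rewrite (_ : [set q | _] = [set q : 'rV[R]_K | in_union (U y) q] `|`
      [set q : 'rV[R]_K | select y0 U s q = y]).
    exact: (caratheodory_measurable_setU mU IHs).
  apply/seteqP; split => q /=; first by case: in_union; [left|right].
  by case: in_union => // -[].
rewrite (_ : [set q | _] = [set q : 'rV[R]_K | select y0 U s q = y] `\`
    [set q : 'rV[R]_K | in_union (U y') q]).
  exact: (caratheodory_measurable_setD IHs mU).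
apply/seteqP; split => q /=; first by case: in_union => [/ne|].
by case: in_union => -[].
Qed.

Lemma select_unique s (q : 'rV[R]_K) y :
  y \in s -> (forall y', in_union (U y') q = (y' == y)) -> select y0 U s q = y.
Proof.
move=> + Uy; elim: s => //= y' s IHs; rewrite inE Uy eq_sym.
by case: eqP => //= _; apply: IHs.
Qed.

End DecisionList.

Theorem corollary4p3 (R : realType) (K : nat) (Y : {fset R})
    (h : simplex R K -> Y)
    (hmeas : forall y : Y, simplex_measurable [set p | h p = y])
    (eps : R) (eps_gt0 : 0 < eps) :
  exists heps : simplex R K -> Y,
    [/\ computable heps,
        box_function (fun p => val (heps p)),
        simplex_measurable [set p | h p <> heps p] &
        (simplex_measure [set p | h p <> heps p] <= eps%:E)%E].
Proof.
pose chart := @simplex_chart R K; pose mu := @lebesgue_outer R K.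
pose A y := chart @` [set p | h p = y].
pose y0 : Y := h (freq_simplex R [ffun _ : 'I_1 => ord0 : 'I_K.+1]).
have Y_gt0 : 0 < #|{: Y}|%:R :> R by rewrite ltr0n; apply/card_gt0P; exists y0.
have sqrt_gt0 : 0 < Num.sqrt K.+1%:R :> R by rewrite sqrtr_gt0 ltr0n.
(* Each value contributes two errors, what [U y] misses and what it adds, and the
   measure of the simplex is [Num.sqrt K.+1%:R] times that of the chart. *)
pose delta := eps / Num.sqrt K.+1%:R / #|{: Y}|%:R / 2.
have delta_gt0 : 0 < delta by rewrite !divr_gt0.
have /choice[U approxU] y : exists l : seq (rat_box K),
    (mu (A y `\` [set q | in_union l q]) <= delta%:E)%E /\
    (mu ([set q | in_union l q] `\` A y) <= delta%:E)%E.
  by apply: caratheodory_approx => //; [apply: hmeas|apply: chart_image_finite].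
pose g := select y0 U (enum {: Y}).
exists (g \o chart); split.
- exact: computable_select.
- exact: box_function_select.
- rewrite /simplex_measurable.
  rewrite (_ : _ @` _ = \big[setU/set0]_(y <- enum {: Y}) (A y `\` [set q | g q = y])).
    elim/big_ind : _ => [||y _].
    + exact: caratheodory_measurable_set0.
    + exact: caratheodory_measurable_setU.
    + by apply: caratheodory_measurable_setD; [apply: hmeas|apply: caratheodory_select].
  rewrite -bigcup_seq; apply/seteqP; split => [_ [p /= hp <-]|q [y _ [[p hp <-] gp]]].
    exists (h p); first by rewrite /= mem_enum.
    by split=> [|gp]; [exists p|apply: hp].
  by exists p => //= hp'; apply: gp; rewrite /= -hp' hp.
rewrite /simplex_measure -/chart -/mu.
pose err y := (A y `\` [set q | in_union (U y) q]) `|` ([set q | in_union (U y) q] `\` A y).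
have bad_err : chart @` [set p | h p <> (g \o chart) p] `<=`
    \big[setU/set0]_(y <- enum {: Y}) err y.
  move=> _ [p hp <-]; rewrite -bigcup_seq; apply: contrapT => no_err.
  apply: hp; apply/esym; apply: select_unique; first by rewrite mem_enum.
  move=> y; have : ~ err y (chart p).
    by move=> erry; apply: no_err; exists y => //=; rewrite mem_enum.
  have AyE : A y (chart p) <-> h p = y.
    by split=> [[q hq /simplex_chart_inj <-]|]; last by exists p.
  rewrite /err /=; case: in_union => no.
    by apply/esym/eqP/esym/AyE; apply: contrapT => nA; apply: no; right.
  by apply/esym/eqP => yE; apply: no; left; split => //; apply/AyE.
have bad_le : (mu (chart @` [set p | h p <> (g \o chart) p]) <=
    (delta * 2 * #|{: Y}|%:R)%:E)%E.
  apply: le_trans (le_lebesgue_outer bad_err) _.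
  apply: le_trans (lebesgue_outer_bigsetU _ _) _.
  apply: le_trans (_ : (\sum_(y <- enum {: Y}) (delta * 2)%:E <= _)%E).
    apply: lee_sum => y _; apply: le_trans (outer_measureU2 _ _ _) _.
    have [le1 le2] := approxU y.
    by rewrite mulr_natr mulr2n EFinD leeD.
  by rewrite sumEFin lee_fin big_const_seq count_predT -cardE iter_addr_0
    -[leLHS]mulr_natr.
apply: le_trans (lee_wpmul2l _ bad_le) _; first by rewrite lee_fin ltW.
rewrite -EFinM lee_fin /delta divfK // divfK ?gt_eqF // mulrCA mulfV ?gt_eqF //.
by rewrite mulr1.
Qed.
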